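(* Let $P\subsetneq l_\infty^n$ be a convex polyhedron with $\mathrm{int}(P)\neq\emptyset$. Then $P$ is injective if and only if for every $p\in\partial P$ the convex polyhedral cone $K:=\mathrm{T}_pP-p$ has the following property: there is a facet $F\in\mathrm{Facets}^*([-1,1]^n,K)$ such that $-F\notin\mathrm{Facets}^*([-1,1]^n,K)$.
   Context: $l_\infty^n$ denotes $\mathbb{R}^n$ endowed with the metric induced by the maximum norm $\|\cdot\|_\infty$; subsets of $l_\infty^n$ carry the induced metric. A metric space $X$ is called injective if for any metric spaces $A,B$, any isometric embedding $i\colon A\to B$ and any $1$-Lipschitz (i.e. distance nonincreasing) map $f\colon A\to X$, there is a $1$-Lipschitz map $g\colon B\to X$ with $g\circ i=f$. A convex polyhedron in $\mathbb{R}^n$ is a finite intersection of closed half-spaces (with the empty intersection being $\mathbb{R}^n$). A cone is a subset $C\subset\mathbb{R}^n$ such that $x\in C$ implies $\lambda x\in C$ for all $\lambda\ge0$; a convex polyhedral cone is a convex polyhedron that is also a cone. For a nonempty convex polyhedron $P$ and $p\in P$, the tangent cone is $\mathrm{T}_pP:=\bigcup_{m\in\mathbb{N}}\bigl(p+m(P-p)\bigr)$; the set $\mathrm{T}_pP-p$ is a convex polyhedral cone. For an $n$-dimensional convex polyhedron $P$, $\mathrm{Facets}(P)$ is the set of its $(n-1)$-dimensional faces, and for a subset $S\subset\mathbb{R}^n$, $\mathrm{Facets}^*(P,S):=\{F\in\mathrm{Facets}(P):\mathrm{relint}(F)\cap S\neq\emptyset\}$, where $\mathrm{relint}$ denotes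 relative interior. $\mathrm{int}$ and $\partial$ denote topological interior and boundary in $\mathbb{R}^n$. *)

(* Defs.v *)
From HB Require Import structures.
From mathcomp Require Import all_boot all_order all_algebra.
From mathcomp Require Import all_classical all_reals all_analysis.

Set Implicit Arguments.
Unset Strict Implicit.
Unset Printing Implicit Defensive.

Import Order.TTheory GRing.Theory Num.Theory.
Import numFieldNormedType.Exports.

Local Open Scope classical_set_scope.
Local Open Scope ring_scope.

Section matrix_metric.
Context {R : realType} {m n : nat}.
Implicit Types x y : 'M[R]_(m, n).

Definition matrix_dist x y : R := `|x - y|.

Lemma matrix_dist_ge0 x y : 0 <= matrix_dist x y.
Proof. exact: normr_ge0. Qed.

Lemma matrix_dist_positivity x y : matrix_dist x y = 0 -> x = y.
Proof. by move/normr0_eq0/eqP; rewrite subr_eq0 => /eqP. Qed.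

Lemma ball_matrix_dist x d : ball x d = [set y | matrix_dist x y < d].
Proof. by rewrite -ball_normE. Qed.

(* The norm of a matrix is the maximum of the absolute values of its entries
   (mx_normrE), so 'rV[R]_n with this metric is l_infty^n. *)
HB.instance Definition _ := @PseudoMetric_isMetric.Build R 'M[R]_(m, n)
  matrix_dist matrix_dist_ge0 matrix_dist_positivity ball_matrix_dist.

End matrix_metric.

Section subset_metric.
Context {R : realType} {X : metricType R} (A : set X).
Implicit Types x y : set_type A.

Definition subset_dist x y : R := mdist (set_val x) (set_val y).

Lemma subset_dist_ge0 x y : 0 <= subset_dist x y.
Proof. exact: mdist_ge0. Qed.

Lemma subset_dist_positivity x y : subset_dist x y = 0 -> x = y.
Proof. by move/mdist_positivity; exact: val_inj. Qed.

Lemma ball_subset_dist x d : ball x d = [set y | subset_dist x y < d].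
Proof. by rewrite -initial_ballE ballEmdist. Qed.

HB.instance Definition _ := @PseudoMetric_isMetric.Build R (set_type A)
  subset_dist subset_dist_ge0 subset_dist_positivity ball_subset_dist.

End subset_metric.

Section injective_metric_space.
Context {R : realType}.

Definition isometric_embedding (A B : metricType R) (i : A -> B) : Prop :=
  forall x y, mdist (i x) (i y) = mdist x y.

(* The library's k.-lipschitz is only available between normed modules. *)
Definition one_lipschitz (A B : metricType R) (f : A -> B) : Prop :=
  forall x y, mdist (f x) (f y) <= mdist x y.

Definition injective_metric (X : metricType R) : Prop :=
  forall (A B : metricType R) (i : A -> B) (f : A -> X),
    isometric_embedding i -> one_lipschitz f ->
    exists2 g : B -> X, one_lipschitz g & g \o i = f.

End injective_metric_space.

Section polyhedra.
Context {R : realType} {n : nat}.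
Implicit Types (P F S H : set 'rV[R]_n) (a p : 'rV[R]_n).

Definition dotv a (x : 'rV[R]_n) : R := \sum_(i < n) a 0 i * x 0 i.

Definition closed_half_space H : Prop :=
  exists a (b : R), a != 0 /\ H = [set x | dotv a x <= b].

Definition convex_polyhedron P : Prop :=
  exists (m : nat) (H : 'I_m -> set 'rV[R]_n),
    (forall i, closed_half_space (H i)) /\ P = \bigcap_i H i.

Definition boundary S : set 'rV[R]_n := closure S `\` S°.

Definition tangent_cone P p : set 'rV[R]_n :=
  \bigcup_(m : nat) [set p + m%:R *: (q - p) | q in P].

Definition affine_set S : Prop :=
  forall x y (t : R), S x -> S y -> S ((1 - t) *: x + t *: y).

Definition affine_hull S : set 'rV[R]_n := smallest affine_set S.

(* No d satisfies this when S is empty. *)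
Definition affine_dim S (d : nat) : Prop :=
  exists p (V : {vspace 'rV[R]_n}),
    affine_hull S = [set p + v | v in [set` V]] /\ \dim V = d.

Definition relint S : set 'rV[R]_n :=
  [set x | S x /\ \forall y \near x, affine_hull S y -> S y].

(* a = 0 is allowed: it yields the improper faces P and set0. *)
Definition face P F : Prop :=
  exists a (b : R), (forall x, P x -> dotv a x <= b) /\
    F = P `&` [set x | dotv a x = b].

(* For n-dimensional P; the equation d.+1 = n avoids the truncated n.-1. *)
Definition Facets P : set (set 'rV[R]_n) :=
  [set F | face P F /\ exists2 d, d.+1 = n & affine_dim F d].

Definition Facets_star P S : set (set 'rV[R]_n) :=
  [set F | Facets P F /\ relint F `&` S !=set0].

End polyhedra.

Definition unit_cube (R : realType) (n : nat) : set 'rV[R]_n :=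
  [set x | forall i, -1 <= x 0 i <= 1].

Arguments unit_cube R n : clear implicits.

(* Main.v *)
Require Import Defs.
From HB Require Import structures.
From mathcomp Require Import all_boot all_order all_algebra.
From mathcomp Require Import all_classical all_reals all_analysis.
From mathcomp Require Import ring lra.

(** Being injective means here being a nonexpansive retract of the whole
    space: an injective set receives an extension of its identity map, and
    conversely the whole space is injective because real-valued 1-Lipschitz
    functions extend, coordinate by coordinate ([injective_iff_retract]).  The
    rest of the argument is about closed convex sets P with an interior point
    q0, such as the polyhedra of the theorem.

    For a coordinate i and a sign s, call i-s-visible (predicate [sees]) the
    points x from which some interior point z of P lies in the cone of those
    displacements whose norm is s times their i-th coordinate.  These sets are
    open and convex and contain the interior of P.  A point p of P satisfies
    the facet condition exactly when for some i and s it is i-s-visible but not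
    i-(-s)-visible ([facet_condition]): the facets of the cube are its sides
    x_i = s, and the cone K meets the relative interior of such a side iff some
    point of P, equivalently some interior point, lies strictly inside the cone
    of direction s e_i at p.

    Everything rests on one remark ([sees_both_coord], [sees_both_preserved]).
    Let r be nonexpansive and fix the interior of P, and let x see P in both
    directions along coordinate i.  The two distances from x to the points seen
    are read off the i-th coordinate, and r does not increase them, so r
    preserves the i-th coordinate of x and r x still sees the same two points.

    If r retracts the space onto P and p is a boundary point at which visibility
    is symmetric in the sign, take x slightly behind p, on the line from q0
    through p.  For each coordinate i along which p sees P, so does x in both
    directions, hence r x and x have the same i-th coordinate.  But
    r x - x is a positive multiple of z - p for an interior point z, and its
    largest coordinate is one along which p sees P; so r x = x and z = p is
    interior, a contradiction ([retract_boundary]).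

    Conversely, average the largest and the smallest 1-Lipschitz extensions of
    the coordinate functions from the interior of P.  The resulting map G is
    nonexpansive, and a fixed point x of G that is i-s-visible is a limit of
    points that are i-(-s)-visible ([averaged_extension]).  Let r be a
    nonexpansive retraction onto the fixed points of G, a limit of resolvents
    ([fixed_point_retraction]).  Under the boundary condition all fixed points
    of G lie in P, so that r is a retraction onto P.  Otherwise let x be a fixed
    point outside P, and move it along the image under r of the segment from x
    to q0.  By the remark above, the coordinates along which x sees P in both
    directions remain so along the way.  At a boundary point p where the path
    reaches P, some i-s-visibility is asymmetric; a fixed point outside P close
    to p inherits i-s-visibility, hence almost has the opposite one, and after a
    small shift followed by r it has it.  So outside P there is a
    fixed point which sees P in both directions along one more coordinate
    ([more_two_sided]); but there are only n coordinates. *)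

Set Implicit Arguments.
Unset Strict Implicit.
Unset Printing Implicit Defensive.

Import Order.TTheory GRing.Theory Num.Theory.
Import numFieldNormedType.Exports.

Local Open Scope classical_set_scope.
Local Open Scope ring_scope.

(** * The maximum norm *)

Section max_norm.
Variables (R : realType) (n : nat).
Implicit Types x y : 'rV[R]_n.

Lemma entry_le_norm x i : `|x 0 i| <= `|x|.
Proof.
rewrite [leRHS]/Num.norm /= mx_normrE; apply/bigmax_geP; right => /=.
by exists (0, i).
Qed.

Lemma norm_le_entries x c :
  0 <= c -> (forall i, `|x 0 i| <= c) -> `|x| <= c.
Proof.
move=> c0 xc; rewrite [leLHS]/Num.norm /= mx_normrE.
by apply/bigmax_leP; split => // -[a i] _ /=; rewrite ord1.
Qed.

Lemma norm_attained x : x != 0 -> exists i, `|x| = `|x 0 i|.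
Proof.
rewrite -normr_eq0 => /mx_norm_neq0[[a i]] /=.
by rewrite ord1 => xi; exists i.
Qed.

Lemma open_ball_sub (S : set 'rV[R]_n) x : S° x ->
  exists2 e, 0 < e & forall y, `|x - y| < e -> S y.
Proof.
move=> /nbhs_ballP[e e0 eS]; exists e => // y xy.
by apply: eS; rewrite -ball_normE.
Qed.

Lemma ball_sub_interior (S : set 'rV[R]_n) x e : 0 < e ->
  (forall y, `|x - y| < e -> S y) -> S° x.
Proof.
move=> e0 eS; apply/nbhs_ballP; exists e => // y.
by rewrite -ball_normE; exact: eS.
Qed.

Lemma shift_near x i c e : 0 < e -> `|c| = e / 2 ->
  `|x - (x + c *: delta_mx 0 i)| < e.
Proof.
move=> e0 ce; rewrite opprD addrA subrr add0r normrN normrZ ce.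
apply: (@le_lt_trans _ _ (e / 2)); last first.
  by rewrite ltr_pdivrMr// ltr_pMr// ltr1n.
rewrite ger_pMr ?divr_gt0//; apply: norm_le_entries => // j; rewrite mxE.
by case: (_ && _); rewrite ?normr1 ?normr0.
Qed.

Lemma unit_sign_sqr (s : R) : `|s| = 1 -> s * s = 1.
Proof. by move=> s1; rewrite -expr2 -real_normK ?num_real// s1 expr1n. Qed.

Lemma norm_of_sign_mul (s c : R) : `|s| = 1 -> s * c = 1 -> `|c| = 1.
Proof. by move=> s1 sc; rewrite -[LHS]mul1r -{1}s1 -normrM sc normr1. Qed.

End max_norm.

(** * Injectivity and nonexpansive retractions *)

Section nonexpansive.
Variables (R : realType).

Definition nonexpansive m n (f : 'rV[R]_m -> 'rV[R]_n) :=
  forall x y, `|f x - f y| <= `|x - y|.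

(** McShane's extension: the infimum over a of f a + d(i a, b) is the largest
    1-Lipschitz extension of f along i.  The last clause, that this infimum is
    approached, is what lets fixed points of maps built from such envelopes be
    analysed. *)
Lemma lower_envelope_extension (A : Type) (B : metricType R) (i : A -> B)
    (f : A -> R) (a0 : A) :
  (forall a a', f a - f a' <= mdist (i a) (i a')) ->
  exists F : B -> R, [/\ forall b b', `|F b - F b'| <= mdist b b',
    forall a, F (i a) = f a,
    forall a b, F b <= f a + mdist (i a) b &
    forall b c, F b < c -> exists a, f a + mdist (i a) b < c].
Proof.
move=> fi; pose E b := range (fun a => f a + mdist (i a) b).
have E0 b : E b !=set0 by exists (f a0 + mdist (i a0) b); exists a0.
have lbE b : has_lbound (E b).
  exists (f a0 - mdist (i a0) b) => _ [a _ <-].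
  have := fi a0 a; have := metric_triangle (i a0) b (i a).
  rewrite (metric_sym b); lra.
exists (fun b => inf (E b)); split.
- suff F1 b b' : inf (E b) - inf (E b') <= mdist b b'.
    by move=> b b'; rewrite ler_norml F1 lerNl opprB metric_sym F1.
  rewrite lerBlDr -lerBlDl; apply: lb_le_inf => // _ [a _ <-].
  have : inf (E b) <= f a + mdist (i a) b by apply: ge_inf => //; exists a.
  have := metric_triangle (i a) b' b; rewrite (metric_sym b'); lra.
- move=> a; apply/eqP; rewrite eq_le; apply/andP; split.
    by apply: ge_inf => //; exists a => //; rewrite mdistxx addr0.
  by apply: lb_le_inf => // _ [a' _ <-]; rewrite -lerBlDl metric_sym; exact: fi.
- by move=> a b; apply: ge_inf => //; exists a.
- move=> b c Fc; have d0 : 0 < c - inf (E b) by rewrite subr_gt0.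
  have [_ [a _ <-] ac] := inf_adherent d0 (conj (E0 b) (lbE b)).
  by exists a; move: ac; rewrite subrKC.
Qed.

Definition retraction_onto n (P : set 'rV[R]_n) (f : 'rV[R]_n -> 'rV[R]_n) :=
  [/\ nonexpansive f, forall x, P (f x) & forall x, P x -> f x = x].

(** Extending the identity of P gives a retraction; conversely a map into P is
    extended coordinatewise to a map into the whole space, which is then
    retracted. *)
Lemma injective_iff_retract n (P : set 'rV[R]_n) : P !=set0 ->
  injective_metric (set_type P : metricType R) <->
  exists f, retraction_onto P f.
Proof.
move=> [p0 Pp0]; split.
  move=> inj; have [//|//|g g1 gK] := inj (set_type P) 'rV[R]_n set_val id.
  exists (set_val \o g); split.
  - exact: g1.
  - by move=> x; apply: set_valP.
  - move=> x Px; have /(congr1 (@^~ (SigSub (mem_set Px)))) /= := gK.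
    by move=> /(congr1 set_val).
move=> [r [r1 rP rK]] A B i f isoi f1.
have [[a0 _]|noA] := pselect (exists a : A, True); last first.
  exists (fun=> SigSub (mem_set Pp0)).
    by move=> x y; rewrite mdistxx mdist_ge0.
  by apply/funext => a; case: noA; exists a.
have ext (k : 'I_n) : exists F : B -> R,
    (forall b b', `|F b - F b'| <= mdist b b') /\
    forall a, F (i a) = set_val (f a) 0 k.
  have [|F [F1 FK _ _]] := @lower_envelope_extension A B i
      (fun a => set_val (f a) 0 k) a0.
    move=> a a'; rewrite isoi; apply: le_trans (f1 a a').
    apply: le_trans (ler_norm _) _.
    have := entry_le_norm (set_val (f a) - set_val (f a')) k.
    by rewrite !mxE.
  by exists F.
have [F FP] := choice ext.
pose h b : 'rV[R]_n := \row_k F k b.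
exists (fun b => SigSub (mem_set (rP (h b)))).
  move=> b b'; apply: le_trans (r1 _ _) _.
  apply: norm_le_entries => [|k]; first exact: mdist_ge0.
  by rewrite !mxE; exact: (FP k).1.
apply/funext => a; apply: val_inj => /=.
have -> : h (i a) = set_val (f a).
  by apply/rowP => k; rewrite mxE (FP k).2.
by rewrite rK//; apply: set_valP.
Qed.

End nonexpansive.

(** * Retracting onto the fixed points of a nonexpansive map *)

HB.instance Definition _ (R : realType) (n : nat) := Complete.on 'rV[R]_n.

Section fixed_points.
Variables (R : realType) (n : nat) (G : 'rV[R]_n -> 'rV[R]_n).
Hypothesis G1 : nonexpansive G.

(** The right-hand side is a contraction of ratio l in y. *)
Lemma resolvent_exists (l : R) x : 0 <= l < 1 ->
  exists y, y = (1 - l) *: x + l *: G y.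
Proof.
move=> /andP[l0 l1]; pose f y := (1 - l) *: x + l *: G y.
have fT : set_fun setT setT f by [].
suff ctr : is_contraction (mkfun fT).
  have [||y _ yf] := banach_fixed_point ctr; first exact: closedT.
    by exists 0.
  by exists y.
exists (NngNum l0); split => // -[y z] _ /=.
rewrite /f opprD addrACA subrr add0r -scalerBr normrZ ger0_norm//.
by rewrite ler_wpM2l.
Qed.

(** The resolvents y_l, defined by y_l x = (1 - l) x + l G (y_l x), are
    nonexpansive and fix the fixed points of G, and G moves y_l x by at most
    2 (1 - l) |x - p|.  Taking l to 1 along an ultrafilter makes them converge
    pointwise without any choice of subsequences depending on x. *)
Lemma fixed_point_retraction p : G p = p ->
  exists r : 'rV[R]_n -> 'rV[R]_n, [/\ nonexpansive r,
    forall x, G (r x) = r x & forall x, G x = x -> r x = x].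
Proof.
move=> Gp; have [l [l01 lk]] : exists l : nat -> R,
    (forall k, 0 <= l k < 1) /\ forall k, 1 - l k = k.+1%:R^-1.
  exists (fun k => k%:R / k.+1%:R); split => k.
    by rewrite divr_ge0//= ltr_pdivrMr ?mul1r ?ltr_nat.
  by rewrite -[X in X - _](@divff _ k.+1%:R)// -mulrBl -natrB// subSnn div1r.
have [y yE] : exists y : nat -> 'rV[R]_n -> 'rV[R]_n,
    forall k x, y k x = (1 - l k) *: x + l k *: G (y k x).
  have /choice[f fE] : forall kx : nat * 'rV[R]_n, exists y,
    y = (1 - l kx.1) *: kx.2 + l kx.1 *: G y.
    by move=> kx; exact: resolvent_exists.
  by exists (fun k x => f (k, x)) => k x; exact: (fE (k, x)).
have y1 k : nonexpansive (y k).
  move=> a b; have /andP[l0 l1] := l01 k.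
  suff : `|y k a - y k b| <= (1 - l k) * `|a - b| + l k * `|y k a - y k b|.
    nra.
  rewrite [in leLHS]yE [in leLHS](yE k b) opprD addrACA -!scalerBr.
  apply: le_trans (ler_normD _ _) _.
  rewrite !normrZ (ger0_norm l0) [`|1 - _|]ger0_norm; last first.
    by rewrite subr_ge0 ltW.
  by rewrite lerD2l ler_wpM2l.
have yfix k x : G x = x -> y k x = x.
  move=> Gx; have /andP[l0 l1] := l01 k.
  apply/eqP; rewrite -subr_eq0 -normr_le0.
  suff : `|y k x - x| <= l k * `|y k x - x| by nra.
  have yx : y k x - x = l k *: (G (y k x) - x).
    by rewrite {1}yE scalerBl scale1r scalerBr addrAC
               [_ - _ - x]addrAC subrr add0r addrC.
  by rewrite {1}yx normrZ ger0_norm// ler_wpM2l// -{2}Gx.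
have yb k x : `|y k x| <= `|x - p| + `|p|.
  rewrite -[y k x](subrK p); apply: le_trans (ler_normD _ _) _.
  by rewrite lerD2r -{1}(yfix k p Gp); exact: y1.
have Gyb k x : `|G (y k x) - y k x| <= (`|x - p| *+ 2) / k.+1%:R.
  have -> : G (y k x) - y k x = (1 - l k) *: (G (y k x) - x).
    rewrite {2}yE scalerBr [_ *: G _ in RHS]scalerBl scale1r opprD addrA.
    by rewrite addrAC.
  rewrite normrZ lk ger0_norm ?invr_ge0// mulrC ler_wpM2r ?invr_ge0//.
  rewrite -[_ - x](subrKA p) mulr2n; apply: le_trans (ler_normD _ _) _.
  rewrite [`|x - p|]distrC lerD2r -{1}Gp.
  apply: le_trans (G1 _ _) _; rewrite -{1}(yfix k p Gp) distrC.
  by apply: le_trans (y1 _ _ _) _.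
have [U [UU oU]] := ultraFilterLemma eventually_filter.
have ylim x : exists z, forall e, 0 < e -> U [set k | `|z - y k x| < e].
  have /bounded_closed_compact cptB :
      bounded_set (closed_ball_ Num.norm (0 : 'rV[R]_n) (`|x - p| + `|p|)).
    exists (`|x - p| + `|p|); split; first exact: num_real.
    move=> M lM z; rewrite /closed_ball_ /= sub0r normrN => zb.
    exact: le_trans zb (ltW lM).
  have [||z [_ zc]] := cptB _ (y ^~ x @ U).
  - exact: closed_closed_ball_.
  - suff : U [set k | `|0 - y k x| <= `|x - p| + `|p|] by [].
    by apply: filterS (@filterT _ U _) => k _ /=; rewrite sub0r normrN.
  exists z => e e0.
  have [//|Un] := in_ultra_setVsetC [set k | `|z - y k x| < e] UU.
  (* An ultrafilter on a compact set converges to each of its cluster points. *)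
  pose far := y ^~ x @` [set k | ~ `|z - y k x| < e].
  have Ufar : (y ^~ x @ U) far.
    suff : U (y ^~ x @^-1` far) by [].
    by apply: filterS Un => k kn; exists k.
  have [w [[k kn <-]]] := zc far (ball z e) Ufar (nbhsx_ballx z _ e0).
  by rewrite -ball_normE.
have [r rP] := choice ylim.
have rle (c : R) x : (forall e, 0 < e -> c <= x + e) -> c <= x.
  by move=> H; apply/ler_addgt0Pr.
exists r; split.
- move=> a b; apply: rle => e e0; have e2 : 0 < e / 2 by rewrite divr_gt0.
  have [k [/= ka kb]] := filter_ex (filterI (rP a _ e2) (rP b _ e2)).
  rewrite -[r a - _](subrKA (y k a)) -[y k a - _](subrKA (y k b)).
  apply: le_trans (ler_normD _ _) _.
  have := ler_normD (y k a - y k b) (y k b - r b).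
  by have := y1 k a b; rewrite (distrC (y k b) (r b)); lra.
- move=> x; apply/eqP; rewrite -subr_eq0 -normr_le0; apply: rle => e e0.
  have e4 : 0 < e / 4 by rewrite divr_gt0.
  have : U [set k | (`|x - p| *+ 2) / k.+1%:R < e / 2].
    apply: oU; near=> k.
    rewrite /= ltr_pdivrMr// mulrC -ltr_pdivrMr ?divr_gt0//.
    apply: lt_le_trans (archi_boundP _) _; first by rewrite !divr_ge0// ltW.
    rewrite ler_nat; near: k.
    by exists (Num.bound (`|x - p| *+ 2 / (e / 2))) => // m /= /leqW.
  move=> Uk; have [k [/= kx ky]] := filter_ex (filterI (rP x _ e4) Uk).
  rewrite -[G _ - _](subrKA (G (y k x))) -[G (y k x) - _](subrKA (y k x)).
  apply: le_trans (ler_normD _ _) _.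
  have := ler_normD (G (y k x) - y k x) (y k x - r x).
  have := G1 (r x) (y k x); have := le_lt_trans (Gyb k x) ky.
  by rewrite (distrC (y k x) (r x)); lra.
- move=> x Gx; apply/eqP; rewrite -subr_eq0 -normr_le0; apply: rle => e e0.
  by have [k /=] := filter_ex (rP x _ e0); rewrite yfix// add0r => /ltW.
Unshelve. all: by end_near. Qed.

End fixed_points.

(** * Visibility of a convex set along the coordinate directions *)

Section visibility.
Variables (R : realType) (n : nat) (P : set 'rV[R]_n) (q0 : 'rV[R]_n).
Hypothesis convP : forall x y t, P x -> P y -> 0 <= t <= 1 ->
  P ((1 - t) *: x + t *: y).
Hypothesis closedP : closed P.
Hypothesis intP : P° q0.
Implicit Types (x y z p q : 'rV[R]_n) (s t e : R) (i j : 'I_n).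

Let sub_int x : P° x -> P x. Proof. exact: interior_subset. Qed.

(** P contains the image of a ball around q under the homothety of centre x and
    ratio t. *)
Lemma interior_open_segment x q t : P x -> P° q -> 0 < t <= 1 ->
  P° ((1 - t) *: x + t *: q).
Proof.
move=> Px /open_ball_sub[e e0 eP] /andP[t0 t1].
apply: (@ball_sub_interior _ _ _ _ (t * e)); first exact: mulr_gt0.
set m := (1 - t) *: x + t *: q => y ye.
have -> : y = (1 - t) *: x + t *: (q + t^-1 *: (y - m)).
  by rewrite scalerDr scalerA mulfV ?gt_eqF// scale1r addrA -/m subrKC.
apply: convP => //; last by rewrite ltW.
apply: eP; rewrite opprD addrA subrr add0r normrN normrZ distrC.
by rewrite gtr0_norm ?invr_gt0// ltr_pdivrMl.
Qed.

Lemma interior_convex x y t : P° x -> P° y -> 0 <= t <= 1 ->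
  P° ((1 - t) *: x + t *: y).
Proof.
move=> Px Py /andP[]; rewrite le_eqVlt => /predU1P[<- _|t0 t1].
  by rewrite subr0 scale1r scale0r addr0.
by apply: interior_open_segment; rewrite ?t0//; exact: sub_int.
Qed.

Lemma interior_dense x e : P x -> 0 < e -> exists2 z, P° z & `|x - z| < e.
Proof.
move=> Px e0; set d := `|x - q0|; have d0 : 0 <= d := normr_ge0 _.
have ed : 0 < e + d by rewrite ltr_wpDr.
have t01 : 0 < e / (e + d) <= 1.
  by rewrite divr_gt0//= ler_pdivrMr ?mul1r ?lerDl.
pose t := e / (e + d); exists ((1 - t) *: x + t *: q0).
  exact: interior_open_segment.
have -> : x - ((1 - t) *: x + t *: q0) = t *: (x - q0).
  by apply/rowP => k; rewrite !mxE; ring.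
rewrite normrZ gtr0_norm ?divr_gt0// -/d.
by rewrite mulrAC ltr_pdivrMr// ltr_pM2l// ltrDr.
Qed.

(** For s = 1 or s = -1 the inequality says that the displacement from x to z
    attains its norm at coordinate i, with sign s; z = x is a possibility. *)
Definition sees i s x := exists2 z, P° z & `|z - x| <= s * (z - x) 0 i.

(** Translating z along with x keeps z in the open set P°. *)
Lemma sees_open i s x : sees i s x -> \forall y \near x, sees i s y.
Proof.
move=> [z Pz zx].
have [e e0 eP] : exists2 e, 0 < e & forall y, `|z - y| < e -> P° y.
  by apply: open_ball_sub; rewrite (interior_id _).1//; exact: open_interior.
apply/nbhs_ballP; exists e => // y; rewrite -ball_normE/= => xy.
exists (z + (y - x)); last first.
  by have -> : z + (y - x) - y = z - x by apply/rowP => k; rewrite !mxE; ring.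
by apply: eP; rewrite opprD addrA subrr add0r opprB.
Qed.

Lemma sees_convex i s x y t : sees i s x -> sees i s y -> 0 <= t <= 1 ->
  sees i s ((1 - t) *: x + t *: y).
Proof.
move=> [z Pz zx] [w Pw wy] t01; exists ((1 - t) *: z + t *: w).
  exact: interior_convex.
rewrite opprD addrACA -!scalerBr; apply: le_trans (ler_normD _ _) _.
have /andP[t0 t1] := t01.
rewrite !normrZ (ger0_norm t0) ger0_norm ?subr_ge0//.
have -> : s * ((1 - t) *: (z - x) + t *: (w - y)) 0 i =
    (1 - t) * (s * (z - x) 0 i) + t * (s * (w - y) 0 i).
  by rewrite !mxE; ring.
by apply: lerD; rewrite ler_wpM2l// subr_ge0.
Qed.

Lemma sees_interior i s x : P° x -> sees i s x.
Proof. by move=> Px; exists x => //; rewrite subrr normr0 mxE mulr0. Qed.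

Section nonexpansive_fixing.
Variable r : 'rV[R]_n -> 'rV[R]_n.
Hypothesis r1 : nonexpansive r.
Hypothesis rK : forall x, P° x -> r x = x.

(** The distances from r x to the two points that x sees are at most
    s (z_i - x_i) and s (x_i - w_i) respectively, which bounds the i-th
    coordinate of r x from both sides. *)
Lemma sees_both_coord i s x : `|s| = 1 -> sees i s x -> sees i (- s) x ->
  r x 0 i = x 0 i.
Proof.
suff pull s' : `|s'| = 1 -> sees i s' x -> s' * x 0 i <= s' * r x 0 i.
  move=> s1 /(pull _ s1) xr; rewrite -normrN in s1 => /(pull _ s1) rx.
  have s0 : s != 0 by rewrite -normr_eq0 -normrN s1 oner_eq0.
  by apply: (mulfI s0); apply: le_anti; rewrite xr andbT; move: rx; lra.
move=> s1 [z Pz zx].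
have := r1 z x; rewrite rK// => /le_trans/(_ zx).
have := entry_le_norm (z - r x) i; have := ler_norm (s' * (z - r x) 0 i).
by rewrite normrM s1 mul1r !mxE; lra.
Qed.

(** Since r x has the i-th coordinate of x and is not farther from z, it sees
    the same z. *)
Lemma sees_both_preserved i s x : `|s| = 1 -> sees i s x -> sees i (- s) x ->
  sees i s (r x).
Proof.
move=> s1 sx sNx; have rx := sees_both_coord s1 sx sNx.
have [z Pz zx] := sx; exists z => //.
have := r1 z x; rewrite rK// => /le_trans/(_ zx).
by rewrite !mxE rx.
Qed.

End nonexpansive_fixing.

(** If visibility from p is symmetric, the retraction cannot move the points
    just behind p in any of the coordinates along which p sees P; the
    displacement it produces would then have to vanish. *)
Lemma retract_boundary r p : retraction_onto P r -> P p -> ~ P° p ->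
  exists i s, [/\ `|s| = 1, sees i s p & ~ sees i (- s) p].
Proof.
move=> [r1 rP rK] Pp nPp; apply: contrapT => nex.
have sym i s : `|s| = 1 -> sees i s p -> sees i (- s) p.
  by move=> s1 ips; apply: contrapT => ?; apply: nex; exists i, s.
have : \forall x \near p, forall i, sees i 1 p -> sees i 1 x /\ sees i (- 1) x.
  apply: (@filter_forall _ _
    (fun i x => sees i 1 p -> sees i 1 x /\ sees i (- 1) x) (nbhs p) _) => i.
  have [ip|nip] := pselect (sees i 1 p); last by apply: nearW.
  have ipN : sees i (- 1) p by apply: sym; rewrite ?normr1.
  by apply: filterS2 (sees_open ip) (sees_open ipN).
move=> /nbhs_ballP[e e0 eS].
pose d := e / (1 + `|q0 - p|).
have q1 : 0 < 1 + `|q0 - p| by rewrite ltr_wpDr.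
have d0 : 0 < d by rewrite divr_gt0.
have d1 : 0 < 1 + d by rewrite addr_gt0.
(* The size of d puts x in the ball around p just obtained. *)
pose x := p - d *: (q0 - p); pose y := r x.
have xS i : sees i 1 p -> sees i 1 x /\ sees i (- 1) x.
  suff px : ball p e x by exact: (eS x px i).
  rewrite -ball_normE/= /x opprB addrC subrK normrZ gtr0_norm//.
  by rewrite mulrAC ltr_pdivrMr// ltr_pM2l// ltrDr.
(* These weights of y and q0 make z - p proportional to y - x. *)
pose z := (1 - d / (1 + d)) *: y + (d / (1 + d)) *: q0.
have Pz : P° z.
  apply: interior_open_segment => //; first exact: rP.
  by rewrite divr_gt0//= ler_pdivrMr// mul1r lerDr.
have zp : z - p = (1 + d)^-1 *: (y - x).
  apply/rowP => k; rewrite !mxE; field; exact: lt0r_neq0.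
have zp0 : z - p != 0.
  by apply/eqP => /subr0_eq zp0; apply: nPp; rewrite -zp0.
have [i zi] := norm_attained zp0.
have [s s1 sz] : exists2 s, `|s| = 1 & `|(z - p) 0 i| = s * (z - p) 0 i.
  have [?|?] := ger0P ((z - p) 0 i); [exists 1|exists (-1)].
  - by rewrite normr1.
  - by rewrite mul1r.
  - by rewrite normrN1.
  - by rewrite mulN1r.
have sp : sees i s p by exists z => //; rewrite zi sz.
have sNp := sym _ _ s1 sp.
have [s1x sN1x] : sees i 1 x /\ sees i (- 1) x.
  apply: xS; have [s0|s0] := ger0P s; move: s1.
    by rewrite ger0_norm// => <-.
  by rewrite ltr0_norm// => <-.
have rI u : P° u -> r u = u by move=> /sub_int/rK.
have yx := sees_both_coord r1 rI (normr1 _) s1x sN1x.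
move: zp0; rewrite -normr_eq0 zi zp !mxE -/y yx.
by rewrite /x !mxE subrr mulr0 normr0 eqxx.
Qed.

(** The largest and the smallest extension of the i-th coordinate enclose x_i.
    If x is i-s-visible, one of them equals x_i, so at a fixed point of the
    average both do; that the infimum defining the other one is approached
    gives an interior point a which x, once shifted by s e along coordinate i,
    sees in the opposite direction. *)
Lemma averaged_extension : exists G : 'rV[R]_n -> 'rV[R]_n,
  [/\ nonexpansive G, forall x, P° x -> G x = x &
    forall x i s e, `|s| = 1 -> G x = x -> sees i s x -> 0 < e ->
      sees i (- s) (x + (s * e) *: delta_mx 0 i)].
Proof.
have ext s i : `|s| = 1 -> exists F : 'rV[R]_n -> R,
    [/\ forall b b', `|F b - F b'| <= `|b - b'|,
    forall z, P° z -> F z = s * z 0 i,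
    forall z b, P° z -> F b <= s * z 0 i + `|z - b| &
    forall b c, F b < c -> exists2 z, P° z & s * z 0 i + `|z - b| < c].
  move=> s1.
  have [|F [F1 FK Fle Flt]] := @lower_envelope_extension R
      (set_type P°) 'rV[R]_n set_val (fun a => s * set_val a 0 i)
      (SigSub (mem_set intP)).
    move=> z z'; rewrite -mulrBr; apply: le_trans (ler_norm _) _.
    rewrite normrM s1 mul1r.
    by have := entry_le_norm (set_val z - set_val z') i; rewrite !mxE.
  exists F; split.
  - exact: F1.
  - by move=> z Pz; exact: (FK (SigSub (mem_set Pz))).
  - by move=> z b Pz; exact: (Fle (SigSub (mem_set Pz)) b).
  - by move=> b c /Flt[z zc]; exists (set_val z) => //; exact: set_valP.
(* The smallest extension of the i-th coordinate is minus the largest extension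
   of its opposite, so U - L is the sum of the two. *)
have [U UP] := choice (fun i => ext 1 i (normr1 _)).
have [L LP] := choice (fun i => ext (- 1) i (normrN1 _)).
exists (fun x => \row_i ((U i x - L i x) / 2)); split.
- move=> x y; apply: norm_le_entries => // i; rewrite !mxE.
  have [+ _ _ _] := UP i => /(_ x y); have [+ _ _ _] := LP i => /(_ x y).
  by rewrite !ler_norml; lra.
- move=> x Px; apply/rowP => i; rewrite !mxE.
  have [_ -> // _ _] := UP i; have [_ -> // _ _] := LP i; lra.
move=> x i s e s1 Gx [z Pz zx] e0.
have Gi : U i x - L i x = 2 * x 0 i.
  by move: Gx => /rowP/(_ i); rewrite mxE; lra.
have ss := unit_sign_sqr s1.
have [a Pa ax] : exists2 a, P° a & `|a - x| < s * (x 0 i - a 0 i) + e.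
  have [_ _ Ule Ult] := UP i; have [_ _ Lle Llt] := LP i.
  have [s0|s0] := ger0P s; move: s1;
    rewrite ?(ger0_norm s0) ?(ltr0_norm s0) => se.
    have [|a Pa ax] := Ult x (x 0 i + e).
      by have := Lle z x Pz; move: zx; rewrite se !mxE; lra.
    by exists a => //; move: ax; rewrite se; lra.
  have sN : s = - 1 by rewrite -se opprK.
  have [|a Pa ax] := Llt x (- x 0 i + e).
    by have := Ule z x Pz; move: zx; rewrite sN !mxE; lra.
  by exists a => //; move: ax; rewrite sN; lra.
exists a => //; set c := - s * _.
have cE : c = s * (x 0 i - a 0 i) + e.
  rewrite /c !mxE !eqxx mulr1 mulNr -mulrN opprB addrAC mulrDr mulrA ss.
  by rewrite mul1r.
rewrite cE; have c0 := le_lt_trans (normr_ge0 _) ax.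
apply: norm_le_entries => [|j]; first exact: ltW.
have [->|ji] := eqVneq j i.
  rewrite -cE in c0 *.
  by rewrite -[leLHS]mul1r -s1 -normrM -normrN -mulNr (gtr0_norm c0).
apply: le_trans (ltW ax); apply: le_trans (entry_le_norm _ j).
by rewrite !mxE (negbTE ji) mulr0 addr0.
Qed.

(** The last time at which the path is outside P, in the sense of a supremum. *)
Lemma path_meets_boundary (f : R -> 'rV[R]_n) C :
  (forall s t, `|f s - f t| <= `|s - t| * C) -> ~ P (f 0) -> P (f 1) ->
  exists t, [/\ 0 <= t <= 1, P (f t) &
    forall e, 0 < e ->
      exists t', [/\ 0 <= t' <= 1, ~ P (f t') & `|f t - f t'| < e]].
Proof.
move=> fC nP0 P1; pose E := [set t | 0 <= t <= 1 /\ ~ P (f t)].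
have E0 : E 0 by split => //; rewrite lexx ler01.
have ubE : ubound E 1 by move=> t [/andP[]].
have supE : has_sup E by split; [exists 0|exists 1].
have C0 : 0 <= C.
  by have := fC 0 1; have := normr_ge0 (f 0 - f 1); rewrite sub0r normrN1; lra.
have C1 : 0 < 1 + C by rewrite ltr_wpDr.
have near_f s t e : 0 < e -> `|s - t| < e / (1 + C) -> `|f s - f t| < e.
  move=> e0; rewrite ltr_pdivlMr// => st.
  apply: le_lt_trans (fC s t) (le_lt_trans _ st).
  by rewrite ler_wpM2l// lerDr.
have t0 : 0 <= sup E by apply: sup_upper_bound.
have t1 : sup E <= 1 by apply: ge_sup => //; exists 0.
exists (sup E); rewrite t0 t1; split => //.
  apply: contrapT => nPt.
  have : (~` P)° (f (sup E)).
    by rewrite (interior_id _).1//; exact: closed_openC.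
  move=> /open_ball_sub[e e0 eP].
  have t1' : sup E < 1.
    by rewrite lt_neqAle t1 andbT; apply: contra_notN nPt => /eqP ->.
  pose d := Num.min (1 - sup E) (e / (1 + C) / 2).
  have d0 : 0 < d by rewrite lt_min subr_gt0 t1' !divr_gt0.
  have : E (sup E + d).
    split.
      apply/andP; split; first by rewrite addr_ge0// ltW.
      by rewrite -lerBrDl ge_min lexx.
    apply: eP; apply: near_f => //.
    rewrite opprD addrA subrr add0r normrN gtr0_norm//.
    rewrite gt_min; apply/orP; right.
    by rewrite ltr_pdivrMr// ltr_pMr ?divr_gt0// ltr1n.
  by move=> /(sup_upper_bound supE); rewrite gerDl leNgt d0.
move=> e e0.
have [t [t01 nPt] tE] := sup_adherent (divr_gt0 e0 C1) supE.
exists t; split => //; apply: near_f => //.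
rewrite ger0_norm ?subr_ge0; first by move: tE; lra.
exact: sup_upper_bound.
Qed.

Definition two_sided x : {set 'I_n} :=
  [set i | `[< sees i 1 x /\ sees i (- 1) x >]].

Lemma two_sidedP x i s : `|s| = 1 ->
  reflect (sees i s x /\ sees i (- s) x) (i \in two_sided x).
Proof.
rewrite inE => s1.
have s11 : s = 1 \/ s = - 1.
  have [s0|s0] := ger0P s; move: s1.
    by rewrite ger0_norm// => ->; left.
  rewrite ltr0_norm// => <-.
  by right; rewrite opprK.
by apply: (iffP (asboolP _)) => -[]; case: s11 => ->; rewrite ?opprK.
Qed.

Hypothesis asym : forall p, P p -> ~ P° p ->
  exists i s, [/\ `|s| = 1, sees i s p & ~ sees i (- s) p].

(** Fixed points of G outside P are pushed along r-images of segments towards P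
    without losing two-sided coordinates; the asymmetry at the boundary point
    where P is reached supplies a new one. *)
Lemma more_two_sided (G r : 'rV[R]_n -> 'rV[R]_n) :
  (forall x i s e, `|s| = 1 -> G x = x -> sees i s x -> 0 < e ->
      sees i (- s) (x + (s * e) *: delta_mx 0 i)) ->
  nonexpansive r -> (forall x, P° x -> r x = x) ->
  (forall x, G (r x) = r x) -> (forall x, G x = x -> r x = x) ->
  forall x, G x = x -> ~ P x ->
  exists y, [/\ G y = y, ~ P y & two_sided x \proper two_sided y].
Proof.
move=> Gsees r1 rP Gr rG x Gx nPx.
have r_sees i y : i \in two_sided y -> i \in two_sided (r y).
  move=> /(two_sidedP _ _ (normr1 _))[iy iNy].
  apply/(two_sidedP _ _ (normr1 _)).
  split; apply: sees_both_preserved => //; rewrite ?normrN1 ?normr1//.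
  by rewrite opprK.
pose f t := r ((1 - t) *: x + t *: q0).
have [|||t [t01 Pp nPnear]] := @path_meets_boundary f `|q0 - x|.
- move=> a b; apply: le_trans (r1 _ _) _; rewrite -normrZ.
  rewrite [leLHS](_ : _ = `|(a - b) *: (q0 - x)|)//; congr `|_|.
  by apply/rowP => k; rewrite !mxE; ring.
- by rewrite /f subr0 scale1r scale0r addr0 rG.
- by rewrite /f subrr scale1r scale0r add0r rP//; exact: sub_int.
have f_sees a i : 0 <= a <= 1 -> i \in two_sided x -> i \in two_sided (f a).
  move=> a01 /(two_sidedP _ _ (normr1 _))[ix iNx]; apply: r_sees.
  apply/(two_sidedP _ _ (normr1 _)).
  by split; apply: sees_convex => //; exact: sees_interior.
(* p is the boundary point reached; [asym] gives a coordinate i outside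
   [two_sided x]. *)
set p := f t in Pp nPnear.
have nPp : ~ P° p.
  by move=> /open_ball_sub[e e0 eP]; have [t' [_ + /eP]] := nPnear e e0.
have [i [s [s1 ip niNp]]] := asym Pp nPp.
have nix : i \notin two_sided x.
  by apply/negP => /(f_sees t _ t01)/(two_sidedP _ _ s1)[].
have /nbhs_ballP[e1 /= e10 e1p] := sees_open ip.
have [a [a01 nPa pa]] := nPnear e1 e10.
set x' := f a in nPa pa.
have ix' : sees i s x' by apply: e1p; rewrite -ball_normE.
have Gx' : G x' = x' by exact: Gr.
have : \forall y \near x', [/\ forall j, j \in two_sided x -> j \in two_sided y,
    sees i s y & ~ P y].
  have near1 :
      \forall y \near x', forall j, j \in two_sided x -> j \in two_sided y.
    apply: (@filter_forall _ _
      (fun j y => j \in two_sided x -> j \in two_sided y) (nbhs x') _) => j.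
    have [jx|_] := boolP (j \in two_sided x); last by apply: nearW.
    have /(two_sidedP _ _ (normr1 _))[jx' jNx'] := f_sees a j a01 jx.
    apply: filterS2 (sees_open jx') (sees_open jNx') => y jy jNy _.
    by apply/(two_sidedP _ _ (normr1 _)).
  have near2 : \forall y \near x', ~ P y.
    by apply: open_nbhs_nbhs; split => //; exact: closed_openC.
  by apply: filterS3 near1 (sees_open ix') near2 => y.
move=> /nbhs_ballP[e2 /= e20 e2x'].
(* Shifting x' by s e_i makes the missing direction visible; r brings the
   shifted point back to the fixed points of G. *)
have e2e : 0 < e2 / 2 by rewrite divr_gt0.
pose y := x' + (s * (e2 / 2)) *: delta_mx 0 i.
have x'y : `|x' - y| < e2.
  by apply: shift_near => //; rewrite normrM s1 mul1r gtr0_norm.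
have yx' : ball x' e2 y by rewrite -ball_normE.
have [yS iy _] := e2x' y yx'.
have iNy := Gsees x' i s _ s1 Gx' ix' e2e.
exists (r y); split => //.
  suff ryx' : ball x' e2 (r y) by have [_ _] := e2x' (r y) ryx'.
  rewrite -ball_normE/=; apply: le_lt_trans x'y.
  by rewrite -{1}(rG x' Gx'); exact: r1.
apply/properP; split; first by apply/fintype.subsetP => j /yS/r_sees.
by exists i => //; apply/r_sees/(two_sidedP _ _ s1).
Qed.

(** A fixed point of G outside P would give, for every k, one with at least k
    two-sided coordinates. *)
Lemma boundary_retract : exists r, retraction_onto P r.
Proof.
have [G [G1 GP Gsees]] := averaged_extension.
have [r [r1 Gr rG]] := fixed_point_retraction G1 (GP q0 intP).
have rP x : P° x -> r x = x by move=> /GP/rG.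
have fixP x : G x = x -> P x.
  move=> Gx; apply: contrapT => nPx.
  have grow k : exists y, [/\ G y = y, ~ P y & (k <= #|two_sided y|)%N].
    elim: k => [|k [y [Gy nPy ky]]]; first by exists x.
    have [z [Gz nPz yz]] := more_two_sided Gsees r1 rP Gr rG Gy nPy.
    by exists z; split => //; exact: leq_ltn_trans ky (proper_card yz).
  have [y [_ _]] := grow n.+1.
  by rewrite ltnNge -[X in (_ <= X)%N]card_ord max_card.
exists r; split => // [x|x Px]; first exact: fixP.
apply/eqP; rewrite -subr_eq0 -normr_le0; apply/ler_addgt0Pr => e e0.
have e2 : 0 < e / 2 by rewrite divr_gt0.
have [z Pz xz] := interior_dense Px e2.
rewrite -[r x - x](subrKA z); apply: le_trans (ler_normD _ _) _.
by have := r1 x z; rewrite (rP z Pz) (distrC z x); lra.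
Qed.

End visibility.

(** * The facets of the cube *)

Section cube_facets.
Variables (R : realType) (n : nat).
Implicit Types (x y v : 'rV[R]_n) (s : R) (i j : 'I_n).

Lemma affine_hull_affine (S : set 'rV[R]_n) : affine_set (affine_hull S).
Proof.
by move=> x y t Sx Sy A AS; apply: AS.1; [exact: Sx|exact: Sy].
Qed.

Lemma sub_affine_hull (S : set 'rV[R]_n) : S `<=` affine_hull S.
Proof. by move=> x Sx A [_]; apply. Qed.

Definition coord_ker i : {vspace 'rV[R]_n} :=
  lker (linfun (mulmxr (delta_mx i 0 : 'cV[R]_n) : 'rV[R]_n -> 'rV[R]_1)).

Lemma coord_kerP i v : (v \in coord_ker i) = (v 0 i == 0).
Proof.
rewrite memv_ker lfunE /= -colE; apply/eqP/eqP => [/rowP/(_ 0)|vi].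
  by rewrite !mxE.
by apply/rowP => k; rewrite !mxE.
Qed.

Lemma dim_coord_ker i : (\dim (coord_ker i)).+1 = n.
Proof.
set f := linfun (mulmxr (delta_mx i 0 : 'cV[R]_n) : 'rV[R]_n -> 'rV[R]_1).
have := limg_ker_dim f fullv; rewrite capfv -/f dimvf /dim /= mul1n => nE.
rewrite -[RHS]nE -addn1; congr (_ + _)%N.
have -> : limg f = fullv.
  apply/eqP; rewrite eqEsubv subvf/=; apply/subvP => w _.
  have -> : w = f (w 0 0 *: delta_mx 0 i).
    rewrite lfunE /= -colE; apply/rowP => k; rewrite ord1 !mxE !eqxx mulr1.
    by [].
  by apply: memv_img; rewrite memvf.
by rewrite dimvf /dim /= mul1n.
Qed.

Definition cube_side i s : set 'rV[R]_n :=
  unit_cube R n `&` [set x | s * x 0 i = 1].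

Lemma unit_cubeE x : unit_cube R n x <-> forall i, `|x 0 i| <= 1.
Proof. by split=> xn i; have := xn i; rewrite ler_norml. Qed.

Lemma unit_cube_scale x : unit_cube R n ((1 + `|x|)^-1 *: x).
Proof.
apply/unit_cubeE => i; rewrite mxE normrM gtr0_norm ?invr_gt0 ?ltr_wpDr//.
rewrite mulrC ler_pdivrMr ?ltr_wpDr// mul1r.
by apply: le_trans (entry_le_norm x i) _; rewrite lerDr.
Qed.

Lemma affine_coord_level i s : affine_set [set x : 'rV[R]_n | s * x 0 i = 1].
Proof.
move=> x y t /= xi yi; rewrite !mxE mulrDr !(mulrCA s) xi yi; ring.
Qed.

(** A point x with s x_i = 1 lies on the line through the centre of the side and
    a point f of the side on the segment from that centre to x. *)
Lemma affine_hull_cube_side i s : `|s| = 1 ->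
  affine_hull (cube_side i s) = [set x | s * x 0 i = 1].
Proof.
move=> s1; have ss := unit_sign_sqr s1; apply/seteqP; split.
  apply: smallest_sub; last by move=> x [].
  exact: affine_coord_level.
move=> x /= xi; pose c := s *: delta_mx 0 i : 'rV[R]_n.
have ci j : c 0 j = if j == i then s else 0.
  by rewrite !mxE eqxx /=; case: (j == i); rewrite ?mulr1 ?mulr0.
have N0 : 0 < 1 + `|x| by rewrite ltr_wpDr.
pose f := (1 + `|x|)^-1 *: x + (1 - (1 + `|x|)^-1) *: c.
have cF : cube_side i s c.
  split; last by rewrite /= ci eqxx.
  by apply/unit_cubeE => j; rewrite ci; case: ifP; rewrite ?s1 ?normr0.
have fF : cube_side i s f.
  have fi : f 0 i = s.
    have -> : s = x 0 i by rewrite -[LHS]mulr1 -xi mulrA ss mul1r.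
    rewrite mxE [X in _ + X]mxE ci eqxx mxE.
    have -> : s = x 0 i by rewrite -[LHS]mulr1 -xi mulrA ss mul1r.
    ring.
  split; last by rewrite /= fi.
  apply/unit_cubeE => j; have [->|ji] := eqVneq j i; first by rewrite fi s1.
  rewrite mxE [X in _ + X]mxE ci (negbTE ji) mulr0 addr0.
  by have /unit_cubeE := unit_cube_scale x; apply.
have -> : x = (1 - (1 + `|x|)) *: c + (1 + `|x|) *: f.
  apply/rowP => j; rewrite /f !mxE; field; exact: lt0r_neq0.
by apply: affine_hull_affine; exact: sub_affine_hull.
Qed.

Lemma dotv_delta i v (a : R) : dotv (a *: delta_mx 0 i) v = a * v 0 i.
Proof.
rewrite /dotv (bigD1 i)//= big1 ?addr0 => [|j ji]; rewrite !mxE ?eqxx ?mulr1//.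
by rewrite (negbTE ji) mulr0 mul0r.
Qed.

Lemma dotvD (a x y : 'rV[R]_n) : dotv a (x + y) = dotv a x + dotv a y.
Proof.
by rewrite /dotv -big_split; apply: eq_bigr => i _; rewrite mxE mulrDr.
Qed.

Lemma dotvZ (a x : 'rV[R]_n) t : dotv a (t *: x) = t * dotv a x.
Proof.
by rewrite /dotv mulr_sumr; apply: eq_bigr => i _; rewrite mxE mulrCA.
Qed.

Lemma dotv_delta_r i (a : 'rV[R]_n) : dotv a (delta_mx 0 i) = a 0 i.
Proof.
rewrite /dotv (bigD1 i)//= big1 ?addr0 => [|j ji]; rewrite !mxE ?eqxx ?mulr1//.
by rewrite (negbTE ji) mulr0.
Qed.

Lemma cube_side_facet i s : `|s| = 1 -> Facets (unit_cube R n) (cube_side i s).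
Proof.
move=> s1; split.
  exists (s *: delta_mx 0 i), 1; split.
    move=> x /unit_cubeE/(_ i) xi; rewrite dotv_delta.
    by apply: le_trans (ler_norm _) _; rewrite normrM s1 mul1r.
  rewrite /cube_side; congr (_ `&` _).
  by apply/seteqP; split => x /=; rewrite dotv_delta.
exists (\dim (coord_ker i)); first exact: dim_coord_ker.
have ss := unit_sign_sqr s1.
exists (s *: delta_mx 0 i), (coord_ker i); split => //.
rewrite affine_hull_cube_side//; apply/seteqP; split => x /=.
  move=> xi; exists (x - s *: delta_mx 0 i); last by rewrite subrKC.
  rewrite /= coord_kerP !mxE !eqxx mulr1 subr_eq0; apply/eqP.
  by rewrite -[RHS]mulr1 -xi mulrA ss mul1r.
move=> [v] /=; rewrite coord_kerP => /eqP vi <-.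
by rewrite !mxE !eqxx mulr1 vi addr0.
Qed.

(** A proper face {a x = b} of the cube that is not empty fixes x_i to the sign
    of a_i whenever a_i is nonzero.  In dimension n - 1 this determines the
    direction space V of the affine hull as the kernel of the i-th coordinate,
    and since a vanishes on V it has no other nonzero coordinate. *)
Lemma cube_facet_side F : Facets (unit_cube R n) F ->
  exists i s, `|s| = 1 /\ F = cube_side i s.
Proof.
move=> [[a [b [leb FE]]] [d dn [p [V [hullE dV]]]]].
have V_sub (A : set 'rV[R]_n) : affine_set A -> F `<=` A ->
    A p /\ forall v, v \in V -> A (p + v).
  move=> affA FA; have hA : affine_hull F `<=` A by exact: smallest_sub.
  split=> [|v Vv]; apply: hA; rewrite hullE; last by exists v.
  by exists 0; rewrite ?addr0//= mem0v.
have [x0 Fx0] : F !=set0.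
  apply: contrapT => nF; have [] := V_sub set0; first by move=> x y t [].
    by move=> x Fx; apply: nF; exists x.
  by [].
have diffV x y : F x -> F y -> x - y \in V.
  move=> /sub_affine_hull + /sub_affine_hull.
  rewrite hullE => -[v Vv <-] [w Vw <-].
  by rewrite opprD addrACA subrr add0r memvB.
have Va v : v \in V -> dotv a v = 0.
  move=> Vv; have [||pb /(_ v Vv)] := V_sub [set x | dotv a x = b].
  - by move=> x y t /= xb yb; rewrite dotvD !dotvZ xb yb; ring.
  - by move=> x; rewrite FE => -[].
  - by rewrite /= dotvD pb; lra.
have Fcube x : F x -> forall j, `|x 0 j| <= 1.
  by rewrite FE => -[/unit_cubeE].
have [i ai] : exists i, a 0 i != 0.
  apply: contrapT => na.
  have a0 x : dotv a x = 0.
    rewrite /dotv big1// => j _; have [->|aj] := eqVneq (a 0 j) 0.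
      by rewrite mul0r.
    by exfalso; apply: na; exists j.
  have b0 : b = 0 by move: Fx0; rewrite FE => -[_ /=]; rewrite a0.
  have Fc x : unit_cube R n x -> F x by rewrite FE => xc; split; rewrite //= a0.
  have : (fullv <= V)%VS.
    apply/subvP => v _.
    have N0 : 1 + `|v| != 0 by rewrite lt0r_neq0// ltr_wpDr.
    rewrite -[v](scalerKV N0) memvZ//.
    have := diffV _ _ (Fc _ (unit_cube_scale v)) (Fc _ (unit_cube_scale 0)).
    by rewrite scaler0 subr0.
  by move=> /dimvS; rewrite dimvf dV /dim /= mul1n -dn ltnn.
pose s := Num.sg (a 0 i).
have s1 : `|s| = 1 by rewrite normr_sg ai.
have ss := unit_sign_sqr s1.
have Fi x : F x -> s * x 0 i = 1.
  move=> Fx; have xc := Fcube x Fx.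
  apply: le_anti; apply/andP; split.
    by apply: le_trans (ler_norm _) _; rewrite normrM s1 mul1r.
  (* If s x_i < 1, replacing x_i by s increases a x, beyond b, in the cube. *)
  have : unit_cube R n (x + (s - x 0 i) *: delta_mx 0 i).
    apply/unit_cubeE => j; rewrite !mxE eqxx /=; have [->|ji] := eqVneq j i.
      by rewrite mulr1 subrKC s1.
    by rewrite mulr0 addr0.
  move=> /leb; rewrite dotvD dotvZ dotv_delta_r.
  have -> : dotv a x = b by move: Fx; rewrite FE => -[].
  have ag0 : 0 < `|a 0 i| by rewrite normr_gt0.
  rewrite gerDl [a 0 i]numEsg -/s mulrA mulrBl ss pmulr_lle0// subr_le0.
  by rewrite mulrC.
have Vi v : v \in V -> v 0 i = 0.
  move=> Vv; have [||pi /(_ v Vv)] := V_sub [set x | s * x 0 i = 1].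
  - exact: affine_coord_level.
  - by move=> x /Fi.
  - rewrite /= mxE mulrDr pi => /eqP; rewrite addrC -subr_eq0 addrK mulf_eq0.
    by rewrite -normr_eq0 s1 oner_eq0/= => /eqP.
have VE : V = coord_ker i.
  apply/eqP; rewrite eqEdim; apply/andP; split.
    by apply/subvP => v /Vi vi; rewrite coord_kerP vi.
  by rewrite dV -ltnS dim_coord_ker dn.
have aj j : j != i -> a 0 j = 0.
  move=> ji; rewrite -dotv_delta_r; apply: Va.
  by rewrite VE coord_kerP mxE eqxx [i == j]eq_sym (negbTE ji).
have aE x : dotv a x = a 0 i * x 0 i.
  by rewrite /dotv (bigD1 i)//= big1 ?addr0// => j /aj ->; rewrite mul0r.
exists i, s; split => //; apply/seteqP; split => x.
  by move=> Fx; split; [move: Fx; rewrite FE => -[]|exact: Fi].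
move=> [xc /= xi]; rewrite FE; split => //=.
have : dotv a x0 = b by move: Fx0; rewrite FE => -[].
rewrite !aE => <-; congr (_ * _).
have s0 : s != 0 by rewrite -normr_eq0 s1 oner_eq0.
by apply: (mulfI s0); rewrite xi Fi.
Qed.

Lemma relint_cube_side i s x : `|s| = 1 ->
  relint (cube_side i s) x <->
  s * x 0 i = 1 /\ forall j, j != i -> `|x 0 j| < 1.
Proof.
move=> s1; rewrite /relint affine_hull_cube_side//; split.
  move=> [[xc xi] /nbhs_ballP[e /= e0 ex]]; split => // j ji.
  have e2 : 0 < e / 2 by rewrite divr_gt0.
  have move_in c : `|c| = e / 2 -> `|x 0 j + c| <= 1.
    move=> ce; pose y := x + c *: delta_mx 0 j.
    have yi : y 0 i = x 0 i.
      by rewrite !mxE [i == j]eq_sym (negbTE ji) andbF mulr0 addr0.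
    have xy : ball x e y.
      by rewrite -ball_normE; exact: shift_near.
    have [|/unit_cubeE/(_ j)] := ex y xy; first by rewrite /= yi.
    by rewrite !mxE !eqxx mulr1.
  have := move_in _ (gtr0_norm e2).
  have := move_in (- (e / 2)); rewrite normrN => /(_ (gtr0_norm e2)).
  by rewrite !ler_norml ltr_norml; lra.
move=> [xi xj]; split.
  split => //; apply/unit_cubeE => j; have [->|/xj/ltW//] := eqVneq j i.
  by rewrite (norm_of_sign_mul s1 xi).
have : \forall y \near x, forall j, j != i -> `|(y : 'rV[R]_n) 0 j| < 1.
  apply: (@filter_forall _ _
    (fun j (y : 'rV[R]_n) => j != i -> `|y 0 j| < 1) (nbhs x) _) => j.
  have [->|ji] := eqVneq j i; first by apply: nearW.
  have d0 : 0 < 1 - `|x 0 j| by rewrite subr_gt0 xj.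
  apply/nbhs_ballP; exists (1 - `|x 0 j|) => // y.
  rewrite -ball_normE/= => xy _.
  have := entry_le_norm (x - y) j; have := lerB_dist (y 0 j) (x 0 j).
  by rewrite !mxE distrC; lra.
apply: filterS => y yj yi; split => //; apply/unit_cubeE => j.
have [->|/yj/ltW//] := eqVneq j i.
by rewrite (norm_of_sign_mul s1 yi).
Qed.

Lemma opp_cube_side i s : [set - x | x in cube_side i s] = cube_side i (- s).
Proof.
apply/seteqP; split => [_ [x [/unit_cubeE xc xi] <-]|x [/unit_cubeE xc xi]].
  split; last by rewrite /= mxE mulrNN.
  by apply/unit_cubeE => j; rewrite mxE normrN.
exists (- x); last exact: opprK.
split; last by rewrite /= mxE mulrN -mulNr.
by apply/unit_cubeE => j; rewrite mxE normrN.
Qed.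

End cube_facets.

(** * The facet condition in terms of visibility *)

Section tangent_cones.
Variables (R : realType) (n : nat) (P : set 'rV[R]_n) (q0 : 'rV[R]_n).
Hypothesis convP : forall x y t, P x -> P y -> 0 <= t <= 1 ->
  P ((1 - t) *: x + t *: y).
Hypothesis intP : P° q0.

(** A point of K in the relative interior of a side is a multiple of q - p for
    some q in P that satisfies the strict inequalities [0 < margin j q]; these
    persist at an interior point z close to q. *)
Lemma sees_of_cube_side p i s x : `|s| = 1 ->
  relint (cube_side i s) x -> [set x - p | x in tangent_cone P p] x ->
  sees P i s p.
Proof.
move=> s1 /(relint_cube_side _ _ s1)[xi xj] [_ [m _ [q Pq <-]] xE].
have {}xE : x = m%:R *: (q - p) by rewrite -xE addrC addKr.
pose margin j (z : 'rV[R]_n) : R :=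
  s * (z - p) 0 i - (j != i)%:R * `|(z - p) 0 j|.
have mq j : 0 < m%:R * margin j q.
  have -> : m%:R * margin j q = s * x 0 i - (j != i)%:R * `|x 0 j|.
    by rewrite /margin xE !mxE normrM normr_nat; ring.
  rewrite xi subr_gt0; have [_|/xj] := eqVneq j i; first by rewrite mul0r.
  by rewrite mul1r.
have m0 : 0 < m%:R :> R.
  rewrite ltr0n lt0n; apply/eqP => m0.
  by have := mq i; rewrite m0 mul0r ltxx.
have near_margin : \forall z \near q, forall j, 0 < margin j z.
  apply: (@filter_forall _ _ (fun j z => 0 < margin j z) (nbhs q) _) => j.
  have mq0 : 0 < margin j q by rewrite -(pmulr_rgt0 _ m0).
  apply/nbhs_ballP; exists (margin j q / 2); first by rewrite /= divr_gt0.
  move=> z; rewrite -ball_normE/= => qz.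
  have zi : s * (q - z) 0 i <= `|q - z|.
    by apply: le_trans (ler_norm _) _; rewrite normrM s1 mul1r entry_le_norm.
  have zj : `|(z - p) 0 j| - `|(q - p) 0 j| <= `|q - z|.
    apply: le_trans (lerB_dist _ _) _; apply: le_trans (entry_le_norm _ j).
    by rewrite distrC !mxE opprB addrA subrK.
  move: qz zi zj mq0; rewrite /margin; case: (j != i) => /=.
    by rewrite !mul1r !mxE; lra.
  by rewrite !mul0r !mxE; have := normr_ge0 (q - z); lra.
have /nbhs_ballP[e /= e0 eM] := near_margin.
have [z Pz qz] := interior_dense convP intP Pq e0.
have zM j : 0 < margin j z by apply: (eM z); rewrite -ball_normE.
have zi : 0 < s * (z - p) 0 i.
  by have := zM i; rewrite /margin eqxx mul0r subr0.
exists z => //; apply: norm_le_entries => [|j]; first exact: ltW.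
have [->|ji] := eqVneq j i.
  by rewrite -[leLHS]mul1r -{1}s1 -normrM gtr0_norm.
by have := zM j; rewrite /margin ji mul1r subr_gt0 => /ltW.
Qed.

(** Shifting the visible interior point a little in direction s e_i makes the
    i-th coordinate of the displacement strictly dominant, and rescaling it to 1
    gives a point of the relative interior of the side. *)
Lemma cube_side_of_sees p i s : P p -> `|s| = 1 -> sees P i s p ->
  exists2 x, relint (cube_side i s) x &
    [set x - p | x in tangent_cone P p] x.
Proof.
move=> Pp s1 [z0 /open_ball_sub[e e0 eP] z0p].
have ss := unit_sign_sqr s1.
have e2 : 0 < e / 2 by rewrite divr_gt0.
pose z := z0 + (s * (e / 2)) *: delta_mx 0 i.
have Pz : P z.
  by apply: eP; apply: shift_near => //; rewrite normrM s1 mul1r gtr0_norm.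
pose c := s * (z - p) 0 i.
have cE : c = s * (z0 - p) 0 i + e / 2.
  rewrite /c /z !mxE !eqxx mulr1 addrAC mulrDr mulrA ss mul1r.
  by [].
have c0 : 0 < c by have := normr_ge0 (z0 - p); move: z0p; rewrite cE; lra.
have zj j : j != i -> `|(z - p) 0 j| < c.
  move=> ji; apply: (@le_lt_trans _ _ `|z0 - p|); last first.
    by rewrite cE; move: z0p; lra.
  apply: le_trans (entry_le_norm _ j); rewrite !mxE.
  by rewrite (negbTE ji) mulr0 addr0.
exists (c^-1 *: (z - p)).
  apply/(relint_cube_side _ _ s1); split.
    by rewrite mxE mulrCA -/c mulVf// lt0r_neq0.
  move=> j /zj zjc.
  by rewrite mxE normrM gtr0_norm ?invr_gt0// ltr_pdivrMl// mulr1.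
(* The rescaling by c^-1 is a scaling down by t, which stays in P by convexity,
   followed by a scaling up by the integer m. *)
pose m := Num.bound c^-1.
have m_gt : c^-1 < m%:R by apply: archi_boundP; rewrite invr_ge0 ltW.
have m0 : 0 < m%:R :> R by apply: lt_trans m_gt; rewrite invr_gt0.
pose t := (m%:R * c)^-1.
have t01 : 0 <= t <= 1.
  have mc : 0 < m%:R * c by exact: mulr_gt0.
  apply/andP; split; first by rewrite invr_ge0 ltW.
  by rewrite invf_le1// -ler_pdivrMr// mul1r ltW.
exists (p + c^-1 *: (z - p)); last by rewrite addrC addKr.
exists m => //; exists ((1 - t) *: p + t *: z); first exact: convP.
apply/rowP => j; rewrite /t !mxE; field; rewrite !lt0r_neq0//.
Qed.

Lemma facet_condition p : P p ->
  (let K := [set x - p | x in tangent_cone P p] in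
   exists F : set 'rV[R]_n, Facets_star (unit_cube R n) K F /\
     ~ Facets_star (unit_cube R n) K [set - x | x in F]) <->
  exists i s, [/\ `|s| = 1, sees P i s p & ~ sees P i (- s) p].
Proof.
move=> Pp; set K := [set x - p | x in _] => /=.
have starE i s : `|s| = 1 ->
    Facets_star (unit_cube R n) K (cube_side i s) <-> sees P i s p.
  move=> s1; split.
    by move=> [_ [x [xF Kx]]]; exact: sees_of_cube_side xF Kx.
  move=> /(cube_side_of_sees Pp s1)[x xF Kx].
  by split; [exact: cube_side_facet|exists x].
split.
  move=> [F [FK nFK]]; have [i [s [s1 FE]]] := cube_facet_side FK.1.
  exists i, s; split=> //.
    by apply/starE; rewrite // -FE.
  move=> /(starE _ _ _).2 h; apply: nFK; rewrite FE opp_cube_side; apply: h.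
  by rewrite normrN.
move=> [i [s [s1 ips niNp]]]; exists (cube_side i s).
split; first exact/starE.
by rewrite opp_cube_side => /starE h; apply: niNp; apply: h; rewrite normrN.
Qed.

End tangent_cones.

(** * Polyhedra are convex and closed *)

Section polyhedra.
Variables (R : realType) (n : nat) (P : set 'rV[R]_n).
Hypothesis polyP : convex_polyhedron P.

Lemma polyhedron_convex x y t : P x -> P y -> 0 <= t <= 1 ->
  P ((1 - t) *: x + t *: y).
Proof.
have [m [H [HH ->]]] := polyP => Px Py /andP[t0 t1] i _.
have := Px i I; have := Py i I; have [a [b [_ ->]]] := HH i => /= ya xa.
by rewrite dotvD !dotvZ; nra.
Qed.

Lemma polyhedron_closed : closed P.
Proof.
have [m [H [HH ->]]] := polyP; apply: closed_bigI => i _.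
have [a [b [_ ->]]] := HH i.
apply: (@preimage_closed _ _ (dotv a) [set r | r <= b]); last exact: closed_le.
suff cont : continuous (dotv a) by move=> x _; exact: cont.
apply: (@continuous_big R 'I_n +%R 0 xpredT (@add_continuous R) 'rV[R]_n
  (index_enum _) (fun j x => a 0 j * x 0 j)) => j _ x.
by apply: (@cvgM _ _ (nbhs x)); [exact: cvg_cst|exact: coord_continuous].
Qed.

End polyhedra.

Theorem corollary1p3 (R : realType) (n : nat) (P : set 'rV[R]_n)
    (polyP : convex_polyhedron P) (properP : P `<` setT)
    (intP : P° !=set0) :
  injective_metric (set_type P : metricType R) <->
  forall p, boundary P p ->
    let K := [set x - p | x in tangent_cone P p] in
    exists F : set 'rV[R]_n, Facets_star (unit_cube R n) K F /\
      ~ Facets_star (unit_cube R n) K [set - x | x in F].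
Proof.
have [q0 Pq0] := intP.
have convP := polyhedron_convex polyP; have closedP := polyhedron_closed polyP.
have bdry p : boundary P p <-> P p /\ ~ P° p.
  by rewrite /boundary -(closure_id P).1.
rewrite injective_iff_retract; last by exists q0; exact: interior_subset.
split.
  move=> [r rP] p /bdry[Pp nPp]; apply/(facet_condition convP Pq0 Pp).
  exact: (retract_boundary convP Pq0 rP Pp nPp).
move=> cond; apply: (boundary_retract convP closedP Pq0) => p Pp nPp.
by apply/(facet_condition convP Pq0 Pp)/cond/bdry.
Qed.
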